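(* Let $n, d, s, t, a$ be positive integers with $1 \le s \le t$ and $1 \le a < d$, let $D = \{ sd+a, (s+1)d+a, \dots, td+a \}$, and let $D_{\mathrm{even}}$ be the set of even elements of $D$. Then the following hold. (1) If $D_{\mathrm{even}} = \varnothing$, then $f_D(n) = 2$ when $n \ge \min(D)$, and $f_D(n) = 1$ otherwise. (2) If $D_{\mathrm{even}} \ne \varnothing$, then $\left\lfloor \frac{2n}{\min(D_{\mathrm{even}})} \right\rfloor \le f_D(n) \le n + 2$.
   Context: Write $[n] = \{1, \dots, n\}$ and $A \bigtriangleup B = (A \setminus B) \cup (B \setminus A)$. For a set $D$ of positive integers, a family $\mathcal{F} \subseteq 2^{[n]}$ is a $D$-distance family if $|A \bigtriangleup B| \in D$ for every pair of distinct sets $A, B \in \mathcal{F}$ (not every element of $D$ needs to occur as a distance). $f_D(n)$ denotes the maximum size of a $D$-distance family $\mathcal{F} \subseteq 2^{[n]}$. *)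

(* Defs.v *)
From mathcomp Require Import all_boot.

Set Implicit Arguments.
Unset Strict Implicit.
Unset Printing Implicit Defensive.

Definition symdiff (T : finType) (A B : {set T}) : {set T} :=
  (A :\: B) :|: (B :\: A).

Definition distance_family (D : seq nat) (n : nat)
    (F : {set {set 'I_n}}) : bool :=
  [forall A in F, forall B in F, (A != B) ==> (#|symdiff A B| \in D)].

(* The ground set {1, .., n} is modelled by 'I_n = {0, .., n-1}. *)
Definition max_distance_family (D : seq nat) (n : nat) : nat :=
  \max_(F : {set {set 'I_n}} | distance_family D F) #|F|.

(* The set {i * d + a | s <= i <= t}, as a list. *)
Definition distances (d s t a : nat) : seq nat :=
  [seq i * d + a | i <- index_iota s t.+1].

Definition evens (D : seq nat) : seq nat := [seq k <- D | ~~ odd k].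

(* Starting the fold at an element of D makes this the minimum of D whenever
   D is nonempty; min_of [::] is the junk value 0. *)
Definition min_of (D : seq nat) : nat := foldr minn (head 0 D) D.

(* Main.v *)
Require Import Defs.
From mathcomp Require Import all_boot.
From mathcomp Require Import all_algebra zify ring.

(** The upper bound n + 2 is a rank argument.  The matrix of pairwise distances
    of m subsets of an n-element set has rank at most n + 1 over the rationals,
    because the distance from A to B is |A| + \sum_(x in B) (1 - 2 [x in A]), a
    pairing of two vectors of length n + 1 ([card_symdiff_pairing]).  Its
    diagonal is zero, and for distances in D its other entries are all
    congruent to a modulo d.
    As 0 < a < d, some prime p has a smaller exponent v in a than in d; after
    division by p ^ v the matrix becomes modulo p a nonzero multiple of J - I,
    where J is the all-one matrix.  The k x k matrix J - I is invertible
    modulo p unless k = 1 modulo p ([scaled_JsubI_unit]), and k cannot be 1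
    modulo p both for k = m and for k = m - 1, so m - 1 <= n + 1
    ([congruent_distances_bound]).

    The lower bound comes from disjoint blocks of size min(Deven) / 2, any two
    of which are at distance min(Deven).  If D has no even element, three
    distinct sets are impossible since the three distances of a triangle of
    sets have an even sum ([odd_symdiff]), while two sets at distance min(D)
    exist as soon as min(D) <= n. *)

(** * Minima of lists and symmetric differences *)

Lemma foldr_minn_mem (x : nat) (s : seq nat) : foldr minn x s \in x :: s.
Proof.
elim: s => [|y s IHs] /=; first by rewrite inE.
rewrite /minn; case: ifP => _; first by rewrite !inE eqxx orbT.
by move: IHs; rewrite !inE => /orP[->|->] //; rewrite !orbT.
Qed.

Lemma foldr_minn_le (x : nat) (s : seq nat) (y : nat) :
  y \in s -> foldr minn x s <= y.
Proof.
elim: s => [//|z s IHs] /=; rewrite inE => /orP[/eqP->|/IHs le_y].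
  exact: geq_minl.
exact: leq_trans (geq_minr _ _) le_y.
Qed.

Lemma min_of_mem (s : seq nat) : s <> [::] -> min_of s \in s.
Proof.
case: s => // x s _; have := foldr_minn_mem x (x :: s).
by rewrite /min_of [head _ _]/= inE => /orP[/eqP->|//]; rewrite mem_head.
Qed.

Lemma min_of_le (s : seq nat) (x : nat) : x \in s -> min_of s <= x.
Proof. exact: foldr_minn_le. Qed.

Lemma symdiffC (T : finType) (A B : {set T}) : symdiff A B = symdiff B A.
Proof. exact: setUC. Qed.

Lemma symdiffxx (T : finType) (A : {set T}) : symdiff A A = set0.
Proof. by rewrite /symdiff setDv setU0. Qed.

Lemma card_symdiff (T : finType) (A B : {set T}) :
  #|symdiff A B| = #|A :\: B| + #|B :\: A|.
Proof.
rewrite /symdiff cardsU [_ :&: _](_ : _ = set0) ?cards0 ?subn0 //.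
by apply/setP=> x; rewrite !inE; case: (x \in A); case: (x \in B).
Qed.

Lemma card_symdiff_disjoint (T : finType) (A B : {set T}) :
  [disjoint A & B] -> #|symdiff A B| = #|A| + #|B|.
Proof.
move=> dAB; rewrite card_symdiff !(setDidPl _) //.
by rewrite disjoint_sym.
Qed.

(** Hence the three distances between A, B and C cannot all be odd: each of
    the three parities occurs twice in their sum. *)
Lemma odd_symdiff (T : finType) (A B : {set T}) :
  odd #|symdiff A B| = odd #|A| (+) odd #|B|.
Proof.
rewrite card_symdiff -(cardsID B A) -(cardsID A B) !oddD setIC.
by do 3!case: (odd _).
Qed.

Lemma distance_familyP (D : seq nat) (n : nat) (F : {set {set 'I_n}}) :
  reflect {in F &, forall A B, A != B -> #|symdiff A B| \in D}
          (distance_family D F).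
Proof.
apply: (iffP forall_inP) => [H A B AF BF|H A AF].
  by move/(_ A AF)/forall_inP/(_ B BF)/implyP: H.
by apply/forall_inP=> B BF; apply/implyP; apply: H.
Qed.

Lemma leq_max_distance_family (D : seq nat) (n : nat) (F : {set {set 'I_n}}) :
  distance_family D F -> #|F| <= max_distance_family D n.
Proof. by move=> DF; rewrite /max_distance_family leq_bigmax_cond. Qed.

(** * Constructions *)

Lemma card_ord_interval (n l u : nat) :
  u <= n -> #|[set x : 'I_n | l <= x < u]| = u - l.
Proof.
move=> le_un; rewrite -sum1_card -[RHS]muln1 -sum_nat_const_nat.
rewrite (big_nat_widen _ _ _ _ _ le_un) (big_nat_widenl _ 0) // big_mkord.
by apply: eq_bigl => x; rewrite inE /= andbC.
Qed.

Lemma max_distance_family_ge1 (D : seq nat) (n : nat) :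
  1 <= max_distance_family D n.
Proof.
rewrite -(cards1 (set0 : {set 'I_n})); apply: leq_max_distance_family.
by apply/distance_familyP=> A B /set1P-> /set1P->; rewrite eqxx.
Qed.

Lemma max_distance_family_ge2 (D : seq nat) (n m : nat) :
  0 < m <= n -> m \in D -> 2 <= max_distance_family D n.
Proof.
case/andP=> m_gt0 le_mn mD; pose A := [set x : 'I_n | 0 <= x < m].
have cA : #|A| = m by rewrite card_ord_interval ?subn0.
have A0 : set0 != A by rewrite eq_sym -card_gt0 cA.
have dA : #|symdiff set0 A| = m.
  by rewrite card_symdiff_disjoint ?cards0 // disjoints_subset sub0set.
have c2 : #|[set set0; A]| = 2 by rewrite cards2 A0.
rewrite -c2; apply: leq_max_distance_family; apply/distance_familyP=> B C.
by move=> /set2P[]-> /set2P[]->; rewrite ?eqxx // 1?[symdiff A _]symdiffC dA.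
Qed.

(** The consecutive blocks of length k in [n] are disjoint, hence pairwise at
    distance 2k. *)
Lemma max_distance_family_blocks (D : seq nat) (n k : nat) :
  0 < k -> k.*2 \in D -> n %/ k <= max_distance_family D n.
Proof.
move=> k_gt0 kD.
pose B (i : 'I_(n %/ k)) := [set x : 'I_n | i * k <= x < i.+1 * k].
have inB i x : (x \in B i) = (x %/ k == i).
  by rewrite inE -leq_divRL // -ltn_divLR // ltnS eqn_leq andbC.
have cB i : #|B i| = k.
  rewrite card_ord_interval ?mulSn ?addnK // -mulSn.
  by apply: leq_trans (leq_trunc_div n k); rewrite leq_mul2r ltn_ord orbT.
have dB i j : i != j -> [disjoint B i & B j].
  move=> neq_ij; apply/pred0P=> x /=; rewrite !inB.
  by apply: contraNF neq_ij => /andP[/eqP xi /eqP xj]; rewrite -val_eqE /= -xi xj.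
have injB : injective B.
  move=> i j eqB; apply/eqP; apply: contraLR k_gt0 => /dB.
  by rewrite -eqB -setI_eq0 setIid -cards_eq0 cB -leqNgt leqn0.
rewrite -[n %/ k]card_ord -(card_imset _ injB).
apply: leq_max_distance_family; apply/distance_familyP=> _ _ /imsetP[i _ ->] /imsetP[j _ ->] neqB.
rewrite card_symdiff_disjoint ?cB ?addnn //.
by apply: dB; apply: contraNneq neqB => ->.
Qed.

(** * Upper bounds from size and parity *)

Lemma max_distance_family_le1 (D : seq nat) (n : nat) :
  {in D, forall m, n < m} -> max_distance_family D n <= 1.
Proof.
move=> Dn; apply/bigmax_leqP=> F /distance_familyP DF.
apply/card_le1_eqP=> A B AF BF; apply/eqP/negPn/negP=> AB.
have := Dn _ (DF _ _ BF AF AB); apply/negP; rewrite -leqNgt.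
by rewrite -[X in _ <= X]card_ord max_card.
Qed.

Lemma max_distance_family_le2 (D : seq nat) (n : nat) :
  {in D, forall m, odd m} -> max_distance_family D n <= 2.
Proof.
move=> oddD; apply/bigmax_leqP=> F /distance_familyP DF.
rewrite leqNgt; apply/negP=> /card_gt2P[A [B [C [[AF BF CF] [AB BC CA]]]]].
have := oddD _ (DF _ _ AF BF AB); have := oddD _ (DF _ _ BF CF BC).
have := oddD _ (DF _ _ CF AF CA); rewrite !odd_symdiff.
by case: (odd #|A|); case: (odd #|B|); case: (odd #|C|).
Qed.

(** * The rank bound *)

Import GRing.Theory Num.Theory.
Local Open Scope ring_scope.

(** The inverse of J - I is (k - 1)^-1 J - I, since J ^ 2 = k J. *)
Lemma scaled_JsubI_unit (K : fieldType) (k : nat) (c : K) :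
  c != 0 -> k%:R != 1 :> K ->
  c *: (const_mx 1 - 1%:M) \in @unitmx K k.
Proof.
move=> c0 k1; set J : 'M[K]_k := const_mx 1; pose e : K := (k%:R - 1)^-1.
have JJ : J *m J = k%:R *: J.
  apply/matrixP=> i j; rewrite !mxE (eq_bigr (fun=> 1)) => [|l _].
    by rewrite sumr_const card_ord mulr1.
  by rewrite !mxE mulr1.
have inv : (J - 1%:M) *m (e *: J - 1%:M) = 1%:M.
  have ek : e * k%:R = 1 + e.
    by apply/eqP; rewrite -subr_eq -{2}[e]mulr1 -mulrBr mulVf // subr_eq0.
  rewrite mulmxBl mul1mx mulmxBr mulmx1 -scalemxAr JJ scalerA ek.
  by apply/matrixP=> i j; rewrite !mxE; ring.
by rewrite unitmxZ ?unitfE //; case: (mulmx1_unit inv).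
Qed.

(** The right-hand side pairs the vector (|A|, 1 - 2 [x in A]), which depends
    only on A, with the vector (1, [x in B]), which depends only on B; this is
    what bounds the rank of a distance matrix. *)
Lemma card_symdiff_pairing (T : finType) (A B : {set T}) :
  #|symdiff A B|%:R =
    #|A|%:R + \sum_x (1 - (x \in A)%:R *+ 2) * (x \in B)%:R :> rat.
Proof.
have cardE (C : {set T}) : #|C|%:R = \sum_x (x \in C)%:R :> rat.
  by rewrite -sum1_card natr_sum big_mkcond; apply: eq_bigr => x _; case: ifP.
rewrite !cardE -big_split; apply: eq_bigr => x _; rewrite !inE.
by case: (x \in A); case: (x \in B).
Qed.

Lemma distance_matrix_rank (n k : nat) (S : 'I_k -> {set 'I_n}) :
  (\rank (\matrix_(i, j) #|symdiff (S i) (S j)|%:R : 'M[rat]_k) <= n.+1)%N.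
Proof.
pose L : 'M[rat]_(k, 1 + n) :=
  row_mx (\col_i #|S i|%:R) (\matrix_(i, x) (1 - (x \in S i)%:R *+ 2)).
pose R : 'M[rat]_(1 + n, k) := col_mx (const_mx 1) (\matrix_(x, j) (x \in S j)%:R).
rewrite [X in \rank X](_ : _ = L *m R); last first.
  apply/matrixP=> i j; rewrite mul_row_col !mxE big_ord1 !mxE mulr1.
  by rewrite card_symdiff_pairing; congr (_ + _); apply: eq_bigr => x _; rewrite !mxE.
exact: leq_trans (mxrankM_maxr _ _) (rank_leq_row _).
Qed.

(** Dividing all distances by q makes the distance matrix a multiple of J - I
    over 'F_p.  Its determinant is an integer that is nonzero modulo p, hence
    nonzero, so the matrix has full rank k over the rationals, where its rank
    is at most n + 1. *)
Lemma nonsingular_distances_bound (p q c n k : nat) (S : 'I_k -> {set 'I_n}) :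
  prime p -> (0 < q)%N -> ~~ (p %| c)%N -> k%:R != 1 :> 'F_p ->
  (forall i j, i != j -> exists e,
     #|symdiff (S i) (S j)| = (q * (c + p * e))%N) ->
  (k <= n.+1)%N.
Proof.
move=> p_pr q_gt0 pNc k1 HS.
pose N : 'M[int]_k := \matrix_(i, j) (#|symdiff (S i) (S j)| %/ q)%N%:Z.
have p0 : p%:R = 0 :> 'F_p by rewrite pchar_Fp_0.
have NF : map_mx intr N = c%:R *: (const_mx 1 - 1%:M) :> 'M['F_p]_k.
  apply/matrixP=> i j; rewrite !mxE; have [->|ij] := eqVneq i j.
    by rewrite symdiffxx cards0 div0n subrr mulr0.
  have [e ->] := HS _ _ ij.
  by rewrite mulKn // -pmulrn natrD natrM p0 mul0r addr0 subr0 mulr1.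
have detN : \det N != 0.
  have : map_mx intr N \in @unitmx 'F_p k.
    rewrite NF; apply: scaled_JsubI_unit k1.
    by rewrite -(dvdn_pcharf (pchar_Fp p_pr)).
  by rewrite unitmxE det_map_mx unitfE; apply: contraNneq => ->.
have uN : map_mx intr N \in @unitmx rat k.
  by rewrite unitmxE det_map_mx unitfE intr_eq0.
have MN : \matrix_(i, j) #|symdiff (S i) (S j)|%:R = q%:R *: map_mx intr N
    :> 'M[rat]_k.
  apply/matrixP=> i j; rewrite !mxE -pmulrn -natrM; congr (_%:R).
  have [->|ij] := eqVneq i j; first by rewrite symdiffxx cards0 div0n muln0.
  by have [e ->] := HS _ _ ij; rewrite mulKn.
have := distance_matrix_rank n k S.
by rewrite MN mxrank_scale_nz ?pnatr_eq0 -?lt0n // mxrank_unit.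
Qed.

(** If d does not divide a, the p-part of d already fails to divide a for some
    prime p. *)
Lemma prime_logn_lt (d a : nat) :
  (0 < d)%N -> ~~ (d %| a)%N -> (0 < a)%N ->
  exists2 p, prime p & (logn p a < logn p d)%N.
Proof.
move=> d_gt0 dNa a_gt0.
have [p p_pr dpNa] : exists2 p : nat, prime p & ~~ (d`_p %| a)%N.
  case: (boolP (all (fun p : nat => d`_p %| a)%N (primes d))) => [/allP H|/allPn[p]].
    by case/negP: dNa; apply/dvdn_partP.
  by rewrite mem_primes => /andP[p_pr _] H; exists p.
by exists p => //; rewrite ltnNge -pfactor_dvdn // -p_part.
Qed.

(** For p of smaller exponent in a = c p ^ v than in d = d' p ^ v p, a distance
    e d + a is p ^ v (c + p e d'), with c prime to p; the preceding bound then
    applies to all m sets, or to m - 1 of them when m = 1 modulo p. *)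
Lemma congruent_distances_bound (d a n m : nat) (S : 'I_m -> {set 'I_n}) :
  (0 < a < d)%N ->
  (forall i j, i != j -> exists e, #|symdiff (S i) (S j)| = (e * d + a)%N) ->
  (m <= n + 2)%N.
Proof.
case/andP=> a_gt0 lt_ad HS; have d_gt0 := ltn_trans a_gt0 lt_ad.
have [|p p_pr lt_log] := prime_logn_lt d a d_gt0 _ a_gt0.
  by rewrite gtnNdvd.
pose q := (p ^ logn p a)%N.
have q_gt0 : (0 < q)%N by rewrite expn_gt0 prime_gt0.
have [c pNc aE] := pfactor_coprime p_pr a_gt0.
have {}pNc : ~~ (p %| c)%N by rewrite -prime_coprime.
have [d' dE] : exists d', d = (d' * (q * p))%N.
  by apply/dvdnP; rewrite /q -expnSr pfactor_dvdn.
have bound k (f : 'I_k -> 'I_m) :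
    injective f -> k%:R != 1 :> 'F_p -> (k <= n.+1)%N.
  move=> inj_f k1; apply: (nonsingular_distances_bound p q c n k (S \o f)) => //.
  move=> i j ij; have [|e /= ->] := HS (f i) (f j); first by rewrite (inj_eq inj_f).
  exists (e * d')%N; rewrite {1}dE {1}aE -/q.
  by rewrite mulnDr addnC mulnCA [(c * q)%N]mulnC; congr (_ + _)%N; lia.
rewrite addn2; have [m1|/(bound m id)] := eqVneq (m%:R : 'F_p) 1; last first.
  by move=> H; apply: leqW; apply: H.
case: m S HS bound m1 => // m S HS bound m1; rewrite ltnS.
apply: (bound m (widen_ord (leqnSn m))).
  by move=> i j /(congr1 val) /= ij; apply: val_inj.
apply/eqP=> m1'; move: m1; rewrite mulrS m1' => /eqP.
by rewrite -subr_eq0 addrK oner_eq0.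
Qed.

Local Close Scope ring_scope.

Lemma max_distance_family_congruent (D : seq nat) (d a n : nat) :
  0 < a < d -> {in D, forall m, exists e, m = e * d + a} ->
  max_distance_family D n <= n + 2.
Proof.
move=> ad DE; apply/bigmax_leqP=> F /distance_familyP DF.
apply: (congruent_distances_bound d a n #|F| (fun i => enum_val i)) => // i j ij.
by apply/DE/DF; rewrite ?enum_valP // (inj_eq enum_val_inj).
Qed.

Theorem theorem1p2 (n d s t a : nat)
    (n_gt0 : 0 < n) (d_gt0 : 0 < d) (s_gt0 : 0 < s) (t_gt0 : 0 < t)
    (a_gt0 : 0 < a) (le_st : s <= t) (lt_ad : a < d) :
  let D := distances d s t a in
  let Deven := evens D in
  (Deven = [::] ->
     (min_of D <= n -> max_distance_family D n = 2) /\
     (n < min_of D -> max_distance_family D n = 1)) /\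
  (Deven <> [::] ->
     (2 * n) %/ min_of Deven <= max_distance_family D n /\
     max_distance_family D n <= n + 2).
Proof.
move=> D Deven.
have DE : {in D, forall m, exists e, m = e * d + a}.
  by move=> _ /mapP[e _ ->]; exists e.
have D_gt0 : {in D, forall m, 0 < m}.
  by move=> _ /DE[e ->]; rewrite addn_gt0 a_gt0 orbT.
have minD : min_of D \in D.
  apply: min_of_mem => D0; have : s * d + a \in D.
    by apply/mapP; exists s; rewrite // mem_index_iota leqnn ltnS.
  by rewrite D0.
split=> [Deven0|/min_of_mem].
  have oddD : {in D, forall m, odd m}.
    move=> m mD; apply/negPn/negP=> even_m.
    have : m \in Deven by rewrite mem_filter even_m.
    by rewrite Deven0.
  split=> [le_n|lt_n]; apply/eqP; rewrite eqn_leq.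
    rewrite max_distance_family_le2 // (max_distance_family_ge2 _ _ (min_of D)) //.
    by rewrite D_gt0.
  rewrite max_distance_family_ge1 max_distance_family_le1 // => m mD.
  exact: leq_trans lt_n (min_of_le _ _ mD).
rewrite mem_filter; set m := min_of Deven => /andP[even_m mD].
have mE : m = m./2.*2 by rewrite even_halfK.
split; last by apply: max_distance_family_congruent DE; rewrite a_gt0.
rewrite mE -mul2n divnMl //; apply: max_distance_family_blocks.
  by rewrite half_gt0 ltn_neqAle D_gt0 // andbT; apply: contraNneq even_m => <-.
by rewrite -mE.
Qed.
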